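(* Let $q>2$ be a prime power, let $n\geq 2$ be an integer, and let $k$ be the largest divisor of $n$ with $k\neq n$. Let $\mathcal{E}$ be a pseudo-cap of $(n-1)$-spaces in $\mathrm{PG}(4n-1,q)$ such that $|\mathcal{E}|>q^{n+k}+q^n-q^k+1$ if $q$ is odd, and $|\mathcal{E}|>q^{n+k}+q^n+2$ if $q$ is even. Then $\mathcal{E}$ is elementary if and only if two distinct elements of $\mathcal{E}$ each induce a partial spread which extends to a Desarguesian $(n-1)$-spread of the corresponding quotient space $\mathrm{PG}(3n-1,q)$.
   Context: $\mathrm{PG}(r,q)$ is the $r$-dimensional projective space over the finite field $\mathbb{F}_q$; dimensions of subspaces are projective. A cap in $\mathrm{PG}(r,q)$ is a set of points such that every three points span a plane. A pseudo-cap in $\mathrm{PG}(4n-1,q)$ is a set of $(n-1)$-dimensional subspaces such that any three (distinct) elements span a $(3n-1)$-space. Field reduction: viewing $\mathbb{F}_{q^n}^{r}$ as an $rn$-dimensional $\mathbb{F}_q$-vector space, each point of $\mathrm{PG}(r-1,q^n)$ corresponds to an $(n-1)$-space of $\mathrm{PG}(rn-1,q)$. The set of $(n-1)$-spaces corresponding to all points of $\mathrm{PG}(r-1,q^n)$ partitions the points of $\mathrm{PG}(rn-1,q)$; a spread obtained in this way (up to choice of identification) is called a Desarguesian $(n-1)$-spread of $\mathrm{PG}(rn-1,q)$. A pseudo-cap in $\mathrm{PG}(rn-1,q)$ is elementary if it is obtained by field reduction from a cap of $\mathrm{PG}(r-1,q^n)$. A partial spread is a set of mutually disjoint $(n-1)$-spaces.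 An element $E\in\mathcal{E}$ induces the partial spread $\{\langle E,F\rangle/E : F\in\mathcal{E}\setminus\{E\}\}$ of $(n-1)$-spaces in the quotient space $\mathrm{PG}(4n-1,q)/E\cong\mathrm{PG}(3n-1,q)$. A partial spread extends to a Desarguesian spread if all its elements belong to some Desarguesian $(n-1)$-spread. *)

(* Defs.v *)
From HB Require Import structures.
From mathcomp Require Import all_boot all_order all_algebra all_field finmap.
From mathcomp Require Import ring_quotient.

Set Implicit Arguments.
Unset Strict Implicit.
Unset Printing Implicit Defensive.

Import GRing.Theory.

Local Open Scope ring_scope.
Local Open Scope quotient_scope.

(* In terms of the underlying vector space, the (m - 1)-dimensional subspaces *)
(* of a projective space are the vector subspaces of dimension m.             *)

(* The library makes the cosets V / E only a Zmodule. *)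
Section QuotientSpace.
Variables (F : fieldType) (V : vectType F) (E : {vspace V}).

Definition quotv : Type := Quotient.quot E.

HB.instance Definition _ := GRing.Zmodule.on quotv.
HB.instance Definition _ := Quotient.on quotv.

Definition quotv_scale (a : F) (x : quotv) : quotv := \pi_quotv (a *: repr x).

Lemma quotv_eqP (u v : V) : (\pi_quotv u == \pi_quotv v) = (u - v \in E).
Proof. by rewrite (Quotient.idealrBE E u v). Qed.

Lemma quotv_piD (u v : V) : \pi_quotv (u + v) = \pi_quotv u + \pi_quotv v.
Proof. exact: (Quotient.pi_add E u v). Qed.

Lemma quotv_piZ (a : F) (v : V) :
  \pi_quotv (a *: v) = quotv_scale a (\pi_quotv v).
Proof.
apply/eqP; rewrite /quotv_scale quotv_eqP -scalerBr. apply: rpredZ; rewrite -quotv_eqP. 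
by rewrite reprK.
Qed.

Fact quotv_scaleA a b x :
  quotv_scale a (quotv_scale b x) = quotv_scale (a * b) x.
Proof. by rewrite -[x]reprK -(quotv_piZ b) -!quotv_piZ scalerA. Qed.

Fact quotv_scale1 : left_id 1 quotv_scale.
Proof. by move=> x; rewrite -[x]reprK -quotv_piZ scale1r. Qed.

Fact quotv_scaleDr : right_distributive quotv_scale +%R.
Proof.
move=> a x y; rewrite -[x]reprK -[y]reprK.
by rewrite -quotv_piD -!quotv_piZ -quotv_piD scalerDr.
Qed.

Fact quotv_scaleDl x : {morph quotv_scale^~ x : a b / a + b}.
Proof.
by move=> a b; rewrite -[x]reprK -!quotv_piZ -quotv_piD scalerDl.
Qed.

HB.instance Definition _ := GRing.Zmodule_isLmodule.Build F quotv
  quotv_scaleA quotv_scale1 quotv_scaleDr quotv_scaleDl.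

Fact quotv_pi_is_linear : linear \pi_quotv.
Proof. by move=> a u v; rewrite quotv_piD quotv_piZ. Qed.

Lemma quotv_repr_mod (v : V) : v - repr (\pi_quotv v) \in E.
Proof. by rewrite -quotv_eqP reprK. Qed.

(* V / E is finite dimensional: it is isomorphic to the complement of E. *)
Fact quotv_vect_iso : Vector.axiom (\dim (E^C)%VS) quotv.
Proof.
pose b := vbasis (E^C)%VS.
pose c (v : V) : 'rV[F]_(\dim (E^C)%VS) :=
  \row_i coord b i (v - projv E v).
have c_lin a u v : c (a *: u + v) = a *: c u + c v.
  apply/rowP=> i; rewrite !mxE -linearP; congr (coord b i _).
  by rewrite linearP opprD addrACA -scalerBr.
have cE v : v \in E -> c v = 0.
  by move=> vE; apply/rowP=> i; rewrite !mxE projv_id // subrr linear0.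
have c_repr v : c (repr (\pi_quotv v)) = c v.
  apply/eqP; rewrite -subr_eq0 -scaleN1r addrC -c_lin scaleN1r addrC.
  by apply/eqP/cE; rewrite -quotv_eqP reprK.
exists (fun x => c (repr x)).
  move=> a x y; rewrite -c_lin -[in LHS](reprK x) -[in LHS](reprK y).
  by rewrite -quotv_pi_is_linear c_repr.
exists (fun r : 'rV_(\dim (E^C)%VS) => \pi_quotv (\sum_i r 0 i *: b`_i)).
  move=> x /=; rewrite -[RHS]reprK; apply/eqP; rewrite quotv_eqP.
  have -> : \sum_i c (repr x) 0 i *: b`_i = repr x - projv E (repr x).
    rewrite [RHS](coord_vbasis (memv_projC E (repr x))).
    by apply: eq_bigr => i _; rewrite mxE.
  by rewrite addrAC subrr sub0r rpredN memv_proj.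
move=> r; rewrite c_repr; apply/rowP=> i; rewrite mxE.
set u := \sum_j _.
have uC : u \in (E^C)%VS.
  by apply: rpred_sum => j _; rewrite rpredZ ?vbasis_mem ?memt_nth.
have -> : projv E u = 0.
  have uT : u \in (E + E^C)%VS by rewrite addv_complf memvf.
  have := daddv_pi_add (capv_compl E) uT.
  rewrite [X in _ + X]daddv_pi_id // 1?capvC ?capv_compl //.
  by move/(canRL (addrK u)); rewrite subrr.
by rewrite subr0 coord_sum_free ?(basis_free (vbasisP _)).
Qed.

HB.instance Definition _ := Lmodule_hasFinDim.Build F quotv quotv_vect_iso.

HB.instance Definition _ := GRing.isLinear.Build F V quotv *:%R \pi_quotv
  quotv_pi_is_linear.

Definition quotv_pi : 'Hom(V, quotv) := linfun \pi_quotv.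

Lemma quotv_piE (v : V) : quotv_pi v = \pi_quotv v.
Proof. exact: lfunE. Qed.

Lemma lker_quotv_pi : lker quotv_pi = E.
Proof.
apply/vspaceP=> v; rewrite memv_ker quotv_piE -(linear0 \pi_quotv).
by rewrite quotv_eqP subr0.
Qed.

Lemma limg_quotv_pi : limg quotv_pi = fullv.
Proof.
apply/vspaceP=> x; rewrite memvf.
by rewrite -[x]reprK -quotv_piE memv_img ?memvf.
Qed.

Lemma dim_quotv : (\dim {:quotv} = \dim {:V} - \dim E)%N.
Proof.
have := limg_ker_dim quotv_pi fullv.
by rewrite lker_quotv_pi limg_quotv_pi (capv_idPr (subvf E)) => <-; rewrite addKn.
Qed.

End QuotientSpace.

Section PseudoCaps.
Variables (F : fieldType) (V : vectType F).
Implicit Types (U : {vspace V}) (C : {fset {vspace V}}).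

Definition cap C : Prop :=
  (forall U, U \in C -> \dim U = 1%N) /\
  (forall U1 U2 U3, U1 \in C -> U2 \in C -> U3 \in C ->
     U1 != U2 -> U1 != U3 -> U2 != U3 -> \dim (U1 + U2 + U3) = 3%N).

Definition pseudo_cap (n : nat) C : Prop :=
  (forall U, U \in C -> \dim U = n) /\
  (forall U1 U2 U3, U1 \in C -> U2 \in C -> U3 \in C ->
     U1 != U2 -> U1 != U3 -> U2 != U3 -> \dim (U1 + U2 + U3) = (3 * n)%N).

End PseudoCaps.

Section FieldReduction.
Variables (F : fieldType) (V : vectType F).

(* An identification of L^r, viewed as a vector space over F, with V.         *)
(* 'rV[L]_r only carries an L-space structure in the library, so F-linearity  *)
(* is spelled out; a%:A is the image of a : F in L.                           *)
Definition F_iso (L : fieldExtType F) (r : nat) (phi : 'rV[L]_r -> V) : Prop :=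
  [/\ bijective phi,
      {morph phi : x y / x + y} &
      forall (a : F) (x : 'rV[L]_r), phi (a%:A *: x) = a *: phi x].

(* For phi as above, U is the image under phi of the L-subspace P. *)
Definition field_reduces (L : fieldExtType F) (r : nat) (phi : 'rV[L]_r -> V)
    (P : {vspace 'rV[L]_r}) (U : {vspace V}) : Prop :=
  forall x : 'rV[L]_r, (phi x \in U) = (x \in P).

Definition desarguesian_spread (n r : nat) (S : {vspace V} -> Prop) : Prop :=
  exists (L : fieldExtType F) (phi : 'rV[L]_r -> V),
    [/\ \dim {:L} = n, F_iso phi &
        forall U : {vspace V},
          S U <-> exists2 P : {vspace 'rV[L]_r},
                    \dim P = 1%N & field_reduces phi P U].

Definition extends_to_desarguesian (n r : nat) (T : {fset {vspace V}}) : Prop :=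
  exists2 S : {vspace V} -> Prop,
    desarguesian_spread n r S & forall U, U \in T -> S U.

Definition elementary (n r : nat) (C : {fset {vspace V}}) : Prop :=
  exists (L : fieldExtType F) (phi : 'rV[L]_r -> V)
         (K : {fset {vspace 'rV[L]_r}}),
    [/\ \dim {:L} = n, F_iso phi, cap K &
        forall U : {vspace V},
          U \in C <-> exists2 P, P \in K & field_reduces phi P U].

Definition induced_partial_spread (C : {fset {vspace V}}) (E : {vspace V}) :
    {fset {vspace quotv E}} :=
  [fset (quotv_pi E @: (E + U))%VS | U in C `\ E]%fset.

End FieldReduction.

(* Main.v *)
From HB Require Import structures.
Require Import Defs.
From mathcomp Require Import all_boot all_order all_algebra all_field finmap.
From mathcomp Require Import zify.

Set Implicit Arguments.
Unset Strict Implicit.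
Unset Printing Implicit Defensive.

(* A Desarguesian spread is the set of L-lines for an action of a field L on    *)
(* the vector space, i.e. of the L-stable subspaces of dimension n = [L : F].   *)
(* Let E1, E2 be the two given elements, with fields L1 acting on V / E1 and L2 *)
(* on V / E2. Both act on V / (E1 + E2), of dimension 2n, and stabilise the     *)
(* images of the other elements of C. Since the elements of C in a 3n-space     *)
(* number at most q^n + 1 (q^n + 2 for q even), more than q^k + 1 of these      *)
(* images are distinct. Two Desarguesian spreads with three common lines share  *)
(* q^d + 1 lines, where q^d is the order of a subfield, so both actions give    *)
(* the same operators up to an isomorphism L1 -> L2 on                          *)
(* V / (E1 + E2). As E1 and E2 are disjoint, V is the fibre product of V / E1   *)
(* and V / E2 over V / (E1 + E2), so L1 acts on V. Finally U = <E1, U> meet     *)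
(* <E2, U> is stable for every other element U of C.                            *)

Import GRing.Theory.

Local Open Scope ring_scope.

(** * Field actions on vector spaces *)

(** Field reduction is handled through actions: [field_action_of_iso] and [iso_of_field_action] pass
    between identifications of [V] with ['rV[L]_r] and actions of [L] on [V], so a set lies in a
    Desarguesian spread when its members are stable n-spaces for one field of degree n. An
    elementary pseudo-cap is stable under some [L], and the action descends to [V / E] for each
    element [E]; this is the direct implication.

    For the converse, project from [E1 + E2] onto a space [W] of dimension 2n. Elements with the
    same image lie, with [E1] and [E2], in one 3n-space, so [pseudo_cap_in_span] bounds the fibres
    and the size of [C] forces more than q^k + 1 images. These are common lines of both induced
    actions on [W]; [common_lines_transfer] then identifies the two fields through a map [theta]
    compatible with the actions. [field_action_fibre_product] lifts the matched actions from
    [V / E1] and [V / E2] to [V]. Each element of [C] is stable under the lift, and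
    [elementary_of_field_action] reads off the cap. *)

Section LinearAlgebra.
Variables (F : fieldType) (V W : vectType F).

Lemma linear_lfun (f : V -> W) :
  linear f -> exists g : 'Hom(V, W), forall v, g v = f v.
Proof.
move=> f_lin.
pose f' : {linear V -> W} := HB.pack f (GRing.isLinear.Build F V W *:%R f f_lin).
by exists (linfun f') => v; rewrite lfunE.
Qed.

End LinearAlgebra.

Section FieldActions.
Variables (F : fieldType) (L : fieldExtType F).

(** An [L]-space structure on [V] extending its [F]-structure, kept as a family of operators so that
    two fields acting on the same space can be compared. The unit law is the case c = 1 of
    [fact_scalar]. *)
Record field_action (V : vectType F) (rho : L -> V -> V) : Prop := FieldAction {
  fact_Dl : forall a b v, rho (a + b) v = rho a v + rho b v;
  fact_Dr : forall a u v, rho a (u + v) = rho a u + rho a v;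
  fact_M : forall a b v, rho (a * b) v = rho a (rho b v);
  fact_scalar : forall c v, rho c%:A v = c *: v }.

Definition stabilizes (V : vectType F) (rho : L -> V -> V) (U : {vspace V}) :=
  forall a v, v \in U -> rho a v \in U.

Section Theory.
Variables (V : vectType F) (rho : L -> V -> V).
Hypothesis rhoP : field_action rho.

Lemma fact_1 v : rho 1 v = v.
Proof. by rewrite -(scale1r (1 : L)) (fact_scalar rhoP) scale1r. Qed.

Lemma fact_Zl c a v : rho (c *: a) v = c *: rho a v.
Proof. by rewrite -mulr_algl (fact_M rhoP) (fact_scalar rhoP). Qed.

Lemma fact_Zr a c v : rho a (c *: v) = c *: rho a v.
Proof.
rewrite -(fact_scalar rhoP) -(fact_scalar rhoP c (rho a v)).
by rewrite -!(fact_M rhoP) mulrC.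
Qed.

Lemma fact_linl v : linear (rho^~ v).
Proof. by move=> c a b; rewrite (fact_Dl rhoP) fact_Zl. Qed.

Lemma fact_linr a : linear (rho a).
Proof. by move=> c u v; rewrite (fact_Dr rhoP) fact_Zr. Qed.

Lemma fact_0l v : rho 0 v = 0.
Proof. by have := fact_Zl 0 0 v; rewrite !scale0r. Qed.

Lemma fact_0r a : rho a 0 = 0.
Proof. by have := fact_Zr a 0 0; rewrite !scale0r. Qed.

Lemma fact_Nl a v : rho (- a) v = - rho a v.
Proof. by rewrite -[- a]scaleN1r fact_Zl scaleN1r. Qed.

Lemma fact_Nr a v : rho a (- v) = - rho a v.
Proof. by rewrite -[- v]scaleN1r fact_Zr scaleN1r. Qed.

Lemma fact_Bl a b v : rho (a - b) v = rho a v - rho b v.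
Proof. by rewrite (fact_Dl rhoP) fact_Nl. Qed.

Lemma fact_Br a u v : rho a (u - v) = rho a u - rho a v.
Proof. by rewrite (fact_Dr rhoP) fact_Nr. Qed.

Lemma fact_K a : a != 0 -> cancel (rho a) (rho a^-1).
Proof. by move=> a0 v; rewrite -(fact_M rhoP) mulVf // fact_1. Qed.

Lemma fact_eq0 a v : (rho a v == 0) = (a == 0) || (v == 0).
Proof.
have [->|a0] := eqVneq a 0; first by rewrite fact_0l eqxx.
apply/eqP/eqP => [av0|->]; last exact: fact_0r.
by rewrite -(fact_K a0 v) av0 fact_0r.
Qed.

Lemma fact_injl v : v != 0 -> injective (rho^~ v).
Proof.
move=> v0 a b /eqP; rewrite -subr_eq0 -fact_Bl fact_eq0 (negPf v0) orbF.
by rewrite subr_eq0 => /eqP.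
Qed.

Lemma stabilizes_mem U a v :
  stabilizes rho U -> a != 0 -> (rho a v \in U) = (v \in U).
Proof.
move=> Uinv a0; apply/idP/idP => [/(Uinv a^-1)|]; last exact: Uinv.
by rewrite fact_K.
Qed.

Lemma stabilizes_add U1 U2 :
  stabilizes rho U1 -> stabilizes rho U2 -> stabilizes rho (U1 + U2).
Proof.
move=> inv1 inv2 a _ /memv_addP[u1 u1P [u2 u2P ->]].
by rewrite (fact_Dr rhoP) memv_add ?inv1 ?inv2.
Qed.

Lemma stabilizes_cap U1 U2 :
  stabilizes rho U1 -> stabilizes rho U2 -> stabilizes rho (U1 :&: U2).
Proof.
by move=> inv1 inv2 a v; rewrite !memv_cap => /andP[/inv1-> /inv2->].
Qed.

Lemma orbit_vspace u : u != 0 ->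
  exists O : {vspace V}, [/\ \dim O = \dim {:L}, stabilizes rho O &
    forall v, v \in O <-> exists a, v = rho a u].
Proof.
move=> u0; have [g gE] := linear_lfun (@fact_linl u).
have OP v : v \in limg g <-> exists a, v = rho a u.
  split=> [/memv_imgP[a _ ->]|[a ->]]; first by exists a; rewrite gE.
  by rewrite -gE memv_img ?memvf.
exists (limg g); split=> //.
  apply: limg_dim_eq; apply/eqP; rewrite capfv; apply/lker0P=> a b.
  by rewrite !gE; apply: fact_injl.
by move=> a v /OP[b ->]; apply/OP; exists (a * b); rewrite (fact_M rhoP).
Qed.

Lemma orbit_full U u v : stabilizes rho U -> \dim U = \dim {:L} ->
  u \in U -> u != 0 -> v \in U -> exists a, v = rho a u.
Proof.
move=> Uinv dimU uU u0 vU; have [O [dimO _ OP]] := orbit_vspace u0.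
apply/OP; suff /eqP-> : O == U by [].
by rewrite eqEdim dimU dimO leqnn andbT; apply/subvP=> w /OP[a ->]; apply: Uinv.
Qed.

(** The partition property of a Desarguesian spread: each stable n-space is the orbit of any of its
    nonzero vectors. *)
Lemma stabilizes_eq U1 U2 u : stabilizes rho U1 -> stabilizes rho U2 ->
  \dim U1 = \dim {:L} -> \dim U2 = \dim {:L} ->
  u != 0 -> u \in U1 -> u \in U2 -> U1 = U2.
Proof.
move=> inv1 inv2 dim1 dim2 u0 u1 u2; apply/eqP; rewrite eqEdim dim1 dim2 leqnn.
rewrite andbT; apply/subvP=> v /(orbit_full inv1 dim1 u1 u0)[a ->].
exact: inv2.
Qed.

Lemma fact_basis_exists m : (m * \dim {:L} <= \dim {:V})%N ->
  exists e : 'I_m -> V, forall a : 'I_m -> L,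
    \sum_i rho (a i) (e i) = 0 -> forall i, a i = 0.
Proof.
move=> le_mV.
(* The induction also carries the stable span [W]: its dimension guarantees a vector outside it,
   whose whole orbit then meets [W] trivially because nonzero scalars are invertible. *)
suff [e [_ [_ _ _ eP]]] : exists e : 'I_m -> V, exists W : {vspace V},
    [/\ \dim W = (m * \dim {:L})%N, stabilizes rho W,
        forall a : 'I_m -> L, \sum_i rho (a i) (e i) \in W &
        forall a : 'I_m -> L, \sum_i rho (a i) (e i) = 0 -> forall i, a i = 0].
  by exists e.
elim: m le_mV => [|m IHm] le_mV.
  exists (fun=> 0), 0%VS; split=> [|a v|a|a _ []//]; rewrite ?dimv0 //.
    by rewrite !memv0 => /eqP->; rewrite fact_0r.
  by rewrite big_ord0 mem0v.
have lt_dim : (m * \dim {:L} < \dim {:V})%N.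
  apply: leq_trans le_mV; rewrite mulSn -[X in (X < _)%N]add0n ltn_add2r.
  exact: adim_gt0.
have [e [W [dimW invW eW eP]]] := IHm (ltnW lt_dim).
have /subvPn[u _ uW] : ~~ ({:V} <= W)%VS.
  by apply/negP=> /dimvS; rewrite dimW leqNgt lt_dim.
have u0 : u != 0 by apply: contraNneq uW => ->; apply: mem0v.
have [O [dimO invO OP]] := orbit_vspace u0.
have OW0 : (O :&: W = 0)%VS.
  apply/eqP; rewrite -subv0; apply/subvP=> v /memv_capP[/OP[a ->] auW].
  have [->|a0] := eqVneq a 0; first by rewrite fact_0l mem0v.
  by move: auW; rewrite stabilizes_mem // (negPf uW).
exists (fun i => oapp e u (unlift ord0 i)), (O + W)%VS; split.
- by rewrite dimv_disjoint_sum // dimO dimW mulSn.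
- exact: stabilizes_add.
- move=> a; rewrite big_ord_recl unlift_none /= memv_add //.
    by apply/OP; exists (a ord0).
  by under eq_bigr do rewrite liftK /=; apply: eW.
move=> a; rewrite big_ord_recl unlift_none /=.
under eq_bigr do rewrite liftK /=; move=> sum0.
have a0 : a ord0 = 0.
  apply/eqP; apply: contraNT uW => a0; rewrite -(stabilizes_mem _ invW a0).
  by move/eqP: sum0; rewrite addr_eq0 => /eqP->; rewrite memvN eW.
move: sum0; rewrite a0 fact_0l add0r => /eP a_lift i.
by case: (unliftP ord0 i) => [j ->|->].
Qed.

End Theory.

Lemma field_action_of_iso (V : vectType F) r (phi : 'rV[L]_r -> V) :
  F_iso phi ->
  exists2 rho, field_action rho & forall a x, phi (a *: x) = rho a (phi x).
Proof.
case=> [[psi phiK psiK] phiD phiZ].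
exists (fun a v => phi (a *: psi v)) => [|a x]; last by rewrite phiK.
split=> [a b v|a u v|a b v|c v]; rewrite ?phiK.
- by rewrite scalerDl phiD.
- by rewrite -phiD -scalerDr -[u in LHS]psiK -[v in LHS]psiK -phiD phiK.
- by rewrite scalerA.
- by rewrite phiZ psiK.
Qed.

Lemma iso_of_field_action (V : vectType F) (rho : L -> V -> V) r :
  field_action rho -> \dim {:V} = (r * \dim {:L})%N ->
  exists2 phi : 'rV[L]_r -> V,
    F_iso phi & forall a x, phi (a *: x) = rho a (phi x).
Proof.
move=> rhoP dimV.
have [|e eP] := fact_basis_exists rhoP (m := r); first by rewrite dimV.
(* Coordinates are taken in [{ffun 'I_r -> L}], an [F]-space of the same dimension as [V], so that
   injectivity of the linear map [g] already makes it bijective. *)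
pose g (a : {ffun 'I_r -> L}) := \sum_i rho (a i) (e i).
have g_lin : linear g.
  move=> c a b; rewrite /g scaler_sumr -big_split; apply: eq_bigr => i _.
  by rewrite !ffunE (fact_Dl rhoP) (fact_Zl rhoP).
have [G GE] := linear_lfun g_lin.
have Ginj : lker G == 0%VS.
  apply/lker0P=> a b /eqP; rewrite -subr_eq0 -linearB /= GE => /eqP/eP ab.
  apply/ffunP=> i; apply/eqP; have := ab i.
  by rewrite !ffunE => /eqP; rewrite subr_eq0.
have Gsurj : limg G = fullv.
  apply/eqP; rewrite eqEdim subvf limg_dim_eq ?capfv ?(eqP Ginj) // dimV.
  by rewrite !dimvf /dim /= card_ord leqnn.
pose phi (x : 'rV[L]_r) := G [ffun i => x 0 i].
exists phi; last first.
  move=> a x; rewrite /phi !GE /g.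
  have [h hE] := linear_lfun (fact_linr rhoP a).
  rewrite -hE linear_sum; apply: eq_bigr => i _ /=.
  by rewrite hE !ffunE mxE (fact_M rhoP).
have phiD : {morph phi : x y / x + y}.
  move=> x y; rewrite /phi -linearD; congr (G _); apply/ffunP=> i.
  by rewrite !ffunE mxE.
have phiZ (a : F) x : phi (a%:A *: x) = a *: phi x.
  rewrite /phi -linearZ; congr (G _); apply/ffunP=> i.
  by rewrite !ffunE mxE mulr_algl.
split=> //; exists (fun v => \row_i (G^-1%VF v : {ffun 'I_r -> L}) i) => [x|v].
  rewrite /phi lker0_lfunK //; apply/rowP=> i.
  by rewrite mxE ffunE.
rewrite /phi -[RHS](@limg_lfunVK _ _ _ G) ?Gsurj ?memvf //.
by congr (G _); apply/ffunP=> i; rewrite ffunE mxE.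
Qed.

Lemma field_reduces_stabilizes (V : vectType F) (rho : L -> V -> V) r
    (phi : 'rV[L]_r -> V) P U :
  bijective phi -> (forall a x, phi (a *: x) = rho a (phi x)) ->
  field_reduces phi P U -> stabilizes rho U.
Proof.
move=> [psi _ psiK] phiM PU a v; rewrite -[v]psiK -phiM !PU; exact: memvZ.
Qed.

Lemma field_reduces_line (V : vectType F) (rho : L -> V -> V) r
    (phi : 'rV[L]_r -> V) U x : field_action rho ->
  bijective phi -> (forall a x, phi (a *: x) = rho a (phi x)) ->
  stabilizes rho U -> \dim U = \dim {:L} -> phi x != 0 -> phi x \in U ->
  field_reduces phi <[x]> U.
Proof.
move=> rhoP phi_bij phiM invU dimU x0 xU y; apply/idP/vlineP => [yU|[a ->]].
  have [a ya] := orbit_full rhoP invU dimU xU x0 yU.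
  by exists a; apply: (bij_inj phi_bij); rewrite ya phiM.
by rewrite phiM invU.
Qed.

Lemma field_action_image (V W : vectType F) (rho : L -> V -> V)
    (g : 'Hom(V, W)) :
  field_action rho -> limg g = fullv -> stabilizes rho (lker g) ->
  exists2 sigma, field_action sigma & forall a v, sigma a (g v) = g (rho a v).
Proof.
move=> rhoP gfull invg.
have gK w : g (g^-1%VF w) = w by rewrite limg_lfunVK // gfull memvf.
have sE a v : g (rho a (g^-1%VF (g v))) = g (rho a v).
  apply/eqP; rewrite -subr_eq0 -linearB -(fact_Br rhoP) -memv_ker invg //.
  by rewrite memv_ker linearB /= gK subrr.
exists (fun a w => g (rho a (g^-1%VF w))) => //.
split=> [a b v|a u v|a b v|c v].
- by rewrite (fact_Dl rhoP) linearD.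
- by rewrite linearD (fact_Dr rhoP) linearD.
- by rewrite (fact_M rhoP) sE.
- by rewrite (fact_scalar rhoP) linearZ /= gK.
Qed.

Lemma stabilizes_img (V W : vectType F) (rho : L -> V -> V)
    (sigma : L -> W -> W) (g : 'Hom(V, W)) U :
  (forall a v, sigma a (g v) = g (rho a v)) ->
  stabilizes rho U -> stabilizes sigma (g @: U).
Proof.
move=> gM invU a _ /memv_imgP[v vU ->].
by rewrite gM memv_img ?invU.
Qed.

Lemma stabilizes_preim (V W : vectType F) (rho : L -> V -> V)
    (sigma : L -> W -> W) (g : 'Hom(V, W)) U :
  (forall a v, sigma a (g v) = g (rho a v)) ->
  stabilizes sigma U -> stabilizes rho (g @^-1: U).
Proof. by move=> gM invU a v; rewrite -!memv_preim -gM; apply: invU. Qed.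

End FieldActions.

(** * Common elements of two Desarguesian spreads of lines *)

Lemma leq_card_vspace (F : finFieldType) (V : vectType F) (U : {vspace V})
    (I : finType) (f : I -> V) :
  injective f -> (forall i, f i \in U) -> (#|I| <= #|F| ^ \dim U)%N.
Proof.
move=> f_inj fU; rewrite -[\dim U]mul1n -card_mx.
pose c i := \row_j coord (vbasis U) j (f i).
apply: (@leq_card _ _ c) => i j /rowP cij; apply: f_inj.
rewrite (coord_vbasis (fU i)) (coord_vbasis (fU j)).
by apply: eq_bigr => l _; have := cij l; rewrite !mxE => ->.
Qed.

(** By linearity the condition on m need only be tested on a basis of [L1], so it cuts out an
    intersection of kernels. This subspace contains 1 and is closed under products, hence is a
    subfield. *)
Lemma multiplier_subfield (F : fieldType) (L1 L2 : fieldExtType F)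
    (theta : L1 -> L2) : linear theta -> theta 1 = 1 ->
  exists K : {subfield L1},
    forall m, m \in K <-> forall x, theta (m * x) = theta m * theta x.
Proof.
move=> theta_lin theta1.
have [t tE] := linear_lfun theta_lin.
pose b := vbasis {:L1}.
have g_ex i : exists g : 'Hom(L1, L2),
    forall m, g m = theta (m * b`_i) - theta m * theta b`_i.
  apply: linear_lfun => c u v; rewrite -!tE mulrDl -scalerAl !linearP.
  by rewrite mulrDl -scalerAl scalerBr opprD addrACA.
have [g gE] := fin_all_exists (fun i : 'I_(\dim {:L1}) => g_ex i).
pose U := (\bigcap_i lker (g i))%VS.
have UP m : m \in U <-> forall x, theta (m * x) = theta m * theta x.
  split=> [mU x|mP].
    rewrite (coord_vbasis (memvf x)) mulr_sumr -!tE !linear_sum mulr_sumr.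
    apply: eq_bigr => i _; rewrite -!scalerAr !linearZ /= -scalerAr; congr (_ *: _).
    have /subv_bigcapP/(_ i isT) : (<[m]> <= U)%VS by [].
    by rewrite -memvE memv_ker gE subr_eq0 -!tE => /eqP.
  rewrite memvE; apply/subv_bigcapP=> i _; rewrite -memvE memv_ker gE mP.
  by rewrite subrr.
have U1 : 1 \in U by apply/UP=> x; rewrite mul1r theta1 mul1r.
have aU : is_aspace U.
  rewrite /is_aspace has_algid1 //=; apply/prodvP=> u v /UP uP /UP vP.
  by apply/UP=> x; rewrite -mulrA !uP vP mulrA.
by exists (ASpace aU).
Qed.

Lemma orbit_transfer (F : fieldType) (L1 L2 : fieldExtType F) (V : vectType F)
    (rho1 : L1 -> V -> V) (rho2 : L2 -> V -> V) (A : {vspace V}) (e : V) :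
  field_action rho1 -> field_action rho2 ->
  stabilizes rho1 A -> stabilizes rho2 A -> \dim A = \dim {:L2} ->
  e \in A -> e != 0 ->
  exists2 theta : L1 -> L2,
    linear theta & forall a, rho1 a e = rho2 (theta a) e.
Proof.
move=> act1 act2 inv1 inv2 dimA eA e0.
have ex a : exists b, rho1 a e == rho2 b e.
  have [|b ->] := orbit_full act2 inv2 dimA eA e0 (v := rho1 a e).
    exact: inv1.
  by exists b.
pose theta a := xchoose (ex a).
have thetaE a : rho1 a e = rho2 (theta a) e by apply/eqP/(xchooseP (ex a)).
exists theta => // c a b; apply: (fact_injl act2 e0) => /=.
by rewrite (fact_linl act2) -!thetaE (fact_linl act1).
Qed.

(** Evaluation of [rho2] at a nonzero vector is injective, so identities between operators are
    identities in [L2]. This makes [rho2] composed with [theta] an action of [L1]. *)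
Lemma faithful_ring_morphism (F : fieldType) (L1 L2 : fieldExtType F)
    (V : vectType F) (rho1 : L1 -> V -> V) (rho2 : L2 -> V -> V)
    (theta : L1 -> L2) :
  field_action rho1 -> field_action rho2 -> (0 < \dim {:V})%N ->
  (forall a v, rho1 a v = rho2 (theta a) v) ->
  [/\ {morph theta : a b / a + b}, {morph theta : a b / a * b} &
      forall c, theta c%:A = c%:A].
Proof.
move=> act1 act2; rewrite lt0n dimv_eq0 -vpick0 => v0 thetaE.
have inj := fact_injl act2 v0.
split=> [a b|a b|c]; apply: inj => /=.
- by rewrite (fact_Dl act2) -!thetaE (fact_Dl act1).
- by rewrite (fact_M act2) -!thetaE (fact_M act1).
- by rewrite -thetaE (fact_scalar act1) (fact_scalar act2).
Qed.

(* Take three common lines A, B, D and e in A, f in B with e + f in D. Both    *)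
(* coordinatisations of A by e differ by a linear theta : L1 -> L2, and the    *)
(* same theta works for f. The m for which theta (m x) = theta m * theta x     *)
(* form a subfield, which contains m whenever e + m f lies on a common line;   *)
(* there are too many such m for the subfield to be proper.                    *)
Lemma common_lines_transfer (F : finFieldType) (L1 L2 : fieldExtType F)
    (W : vectType F) (rho1 : L1 -> W -> W) (rho2 : L2 -> W -> W) (n k : nat)
    (I : finType) (X : I -> {vspace W}) :
  field_action rho1 -> field_action rho2 -> \dim {:L1} = n -> \dim {:L2} = n ->
  \dim {:W} = (2 * n)%N -> (forall d, d %| n -> d != n -> d <= k)%N ->
  injective X -> (forall i, \dim (X i) = n) ->
  (forall i, stabilizes rho1 (X i)) -> (forall i, stabilizes rho2 (X i)) ->
  (#|F| ^ k + 1 < #|I|)%N ->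
  exists theta : L1 -> L2, forall a w, rho1 a w = rho2 (theta a) w.
Proof.
move=> act1 act2 dimL1 dimL2 dimW k_max X_inj dimX inv1 inv2 cardI.
have n_gt0 : (0 < n)%N by rewrite -dimL1; apply: adim_gt0.
have disj i j u : i != j -> u \in X i -> u \in X j -> u = 0.
  move=> ij ui uj; apply/eqP; apply: contraNT ij => u0; apply/eqP/X_inj.
  by apply: (stabilizes_eq act1 _ _ _ _ u0 ui uj); rewrite ?dimX.
have Fk_gt0 : (0 < #|F| ^ k)%N by rewrite expn_gt0 (ltnW (finNzRing_gt1 F)).
have [B _] : exists i : I, i \in I by apply/card_gt0P; apply: leq_trans cardI.
have cardC i : #|predC1 i : {pred I}| = #|I|.-1.
  by rewrite -[in RHS](cardC1 i).
have [A] : exists i : I, i \in predC1 B.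
  apply/card_gt0P; rewrite cardC; case: #|I| cardI => // m.
  by rewrite addn1 ltnS; apply: leq_trans.
rewrite inE => AB.
have [D] : exists D : I, D \notin [set A; B].
  apply/existsP; rewrite -negb_forall; apply: contraTN cardI => /forallP all2.
  rewrite -leqNgt -cardsT (_ : [set: I] = [set A; B]); last first.
    by apply/setP=> i; rewrite [RHS]all2 inE.
  by rewrite cards2 AB addn1 ltnS.
rewrite !inE negb_or => /andP[DA DB].
have AB0 : (X A :&: X B = 0)%VS.
  apply/eqP; rewrite -subv0; apply/subvP=> u /memv_capP[uA].
  by move/(disj _ _ _ AB uA)->; apply: mem0v.
have ABf : (X A + X B)%VS = fullv.
  apply/eqP; rewrite eqEdim subvf dimv_disjoint_sum // !dimX dimW.
  by rewrite mul2n addnn leqnn.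
have ab_uniq a a' b b' : a \in X A -> a' \in X A -> b \in X B -> b' \in X B ->
    a + b = a' + b' -> a = a'.
  move=> aA a'A bB b'B eq; apply/eqP; rewrite -subr_eq0; apply/eqP.
  apply: (disj A B) => //; first exact: memvB.
  suff -> : a - a' = b' - b by apply: memvB.
  by apply/eqP; rewrite subr_eq addrC addrA -subr_eq opprK eq addrC.
have D0 : vpick (X D) != 0 by rewrite vpick0 -dimv_eq0 dimX -lt0n.
have /memv_addP[e eA [f fB def]] : vpick (X D) \in (X A + X B)%VS.
  by rewrite ABf memvf.
have efD : e + f \in X D by rewrite -def memv_pick.
have e0 : e != 0.
  apply: contraNneq D0 => e0; rewrite def e0 add0r; apply/eqP.
  by apply: (disj D B) => //; rewrite -[f]add0r -e0.
have f0 : f != 0.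
  apply: contraNneq D0 => f0; rewrite def f0 addr0; apply/eqP.
  by apply: (disj D A) => //; rewrite -[e]addr0 -f0.
have [|theta th_lin thE] := orbit_transfer act1 act2 (inv1 A) (inv2 A) _ eA e0.
  by rewrite dimX.
(* Apply both operators to [e + f]: the difference lies in [X D], its [e] part vanishes, and what is
   left lies in [X B], which meets [X D] trivially. *)
have thF a : rho1 a f = rho2 (theta a) f.
  apply/eqP; rewrite -subr_eq0; apply/eqP.
  apply: (disj B D); rewrite 1?eq_sym //; first by rewrite memvB ?inv1 ?inv2.
  have -> : rho1 a f - rho2 (theta a) f = rho1 a (e + f) - rho2 (theta a) (e + f).
    rewrite (fact_Dr act1) (fact_Dr act2) thE opprD addrACA subrr.
    by rewrite add0r.
  by rewrite memvB ?inv1 ?inv2.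
(* Every common line except [X B], which has infinite slope, is the graph of a slope [m]; [X A] has
   slope 0. *)
have slope_ex (j : {i : I | i != B}) : exists m, e + rho1 m f \in X (val j).
  case: j => i iB /=.
  have i0 : vpick (X i) != 0 by rewrite vpick0 -dimv_eq0 dimX -lt0n.
  have /memv_addP[u uA [v vB uv]] : vpick (X i) \in (X A + X B)%VS.
    by rewrite ABf memvf.
  have [x ux] := orbit_full act1 (inv1 A) (etrans (dimX A) (esym dimL1)) eA e0 uA.
  have [z vz] := orbit_full act1 (inv1 B) (etrans (dimX B) (esym dimL1)) fB f0 vB.
  have x0 : x != 0.
    apply: contraNneq i0 => x0; apply/eqP/(disj i B) => //; first exact: memv_pick.
    by rewrite uv ux x0 (fact_0l act1) add0r.
  exists (x^-1 * z); rewrite -(stabilizes_mem act1 _ (inv1 i) x0).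
  rewrite (fact_Dr act1) -(fact_M act1) mulrA divff // mul1r -ux -vz -uv.
  exact: memv_pick.
have [m mP] := fin_all_exists slope_ex.
have m_inj : injective m.
  move=> i j mij; apply/val_inj/eqP; apply: contraNT e0 => ij; apply/eqP.
  apply: (ab_uniq _ 0 (rho1 (m i) f) 0); rewrite ?mem0v ?inv1 ?addr0 //.
  by apply: (disj _ _ _ ij (mP i)); rewrite mij.
have th1 : theta 1 = 1.
  apply: (fact_injl act2 e0) => /=.
  by rewrite -thE (fact_1 act1) (fact_1 act2).
have [K KP] := multiplier_subfield th_lin th1.
(* The argument for [thF], with the vector [e + rho1 (m i) f] on the line of slope [m i]. *)
have mK i : m i \in K.
  apply/KP=> x; apply: (fact_injl act2 f0) => /=; rewrite -thF.
  apply/eqP; rewrite -subr_eq0; apply/eqP; apply: (disj (val i) B).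
  - exact: (valP i).
  - have -> : rho1 (m i * x) f - rho2 (theta (m i) * theta x) f =
        rho1 x (e + rho1 (m i) f) - rho2 (theta x) (e + rho1 (m i) f).
      rewrite (fact_Dr act1) (fact_Dr act2) thE opprD addrACA subrr add0r.
      rewrite [m i * x]mulrC (fact_M act1) [theta (m i) * _]mulrC.
      by rewrite (fact_M act2) -thF.
    by rewrite memvB ?inv1 ?inv2.
  - by rewrite memvB ?inv1 ?inv2.
(* The #|I| - 1 > q^k distinct slopes all lie in [K], whereas a proper subfield has degree a proper
   divisor of n, hence at most q^k elements. *)
have Kfull x : x \in K.
  suff /eqP-> : (K : {vspace L1}) == fullv by apply: memvf.
  rewrite eqEdim subvf dimL1 leq_eqVlt; apply/orP; left; rewrite eq_sym.
  apply: contraTT (leq_card_vspace m_inj mK) => dimK.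
  rewrite -ltnNge card_sig cardC.
  apply: (@leq_ltn_trans (#|F| ^ k)); last first.
    by case: #|I| cardI => // c; rewrite addn1.
  rewrite leq_exp2l ?finNzRing_gt1 //; apply: k_max => //.
  by rewrite -dimL1 field_dimS ?subvf.
have thM x y : theta (x * y) = theta x * theta y.
  by have /KP := Kfull x; apply.
exists theta => a w.
have /memv_addP[u uA [v vB ->]] : w \in (X A + X B)%VS by rewrite ABf memvf.
have [x ->] := orbit_full act1 (inv1 A) (etrans (dimX A) (esym dimL1)) eA e0 uA.
have [z ->] := orbit_full act1 (inv1 B) (etrans (dimX B) (esym dimL1)) fB f0 vB.
rewrite (fact_Dr act1) (fact_Dr act2) -!(fact_M act1) !thE !thF !thM.
by rewrite !(fact_M act2).
Qed.

(** * The size of a pseudo-arc *)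

Lemma card_vspace_set (F : finFieldType) (V : vectType F) (U : {vspace V}) :
  #|[set v : finvect_type V | v \in U]| = (#|F| ^ \dim U)%N.
Proof.
rewrite cardsE; case: V U => T c U.
exact: (card_vspace (T := finvect_type {| Vector.sort := T; Vector.class := c |})).
Qed.

Lemma card_bigcup_disjoint (I T : finType) (P : pred I) (S : I -> {set T}) :
  (forall i j v, P i -> P j -> v \in S i -> v \in S j -> i = j) ->
  #|\bigcup_(i | P i) S i| = (\sum_(i | P i) #|S i|)%N.
Proof.
move=> disj.
transitivity (\sum_v \sum_(i | P i) (v \in S i : nat))%N; last first.
  rewrite exchange_big; apply: eq_bigr => i _ /=.
  by rewrite -sum1_card [RHS]big_mkcond; apply: eq_bigr => v _; case: (v \in S i).
rewrite -sum1_card big_mkcond; apply: eq_bigr => v _.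
case: ifP => [/bigcupP[i Pi vi]|/negP v0].
  rewrite (bigD1 i) //= vi big1 ?addn0 // => j /andP[Pj ji].
  apply/eqP; rewrite eqb0; apply: contraNN ji => vj.
  by apply/eqP/(disj j i v).
rewrite big1 // => i Pi; apply/eqP; rewrite eqb0; apply/negP=> vi.
by apply: v0; apply/bigcupP; exists i.
Qed.

Lemma odd_card_involution (T : finType) (f : T -> T) :
  involutive f -> (forall x, f x != x) -> ~~ odd #|T|.
Proof.
move=> fK fN; have f_inj := inv_inj fK.
have ord2 x : order f x = 2%N.
  apply: (@order_cycle _ f [:: x; f x]); rewrite /= ?inE ?eqxx ?fK //=.
    by rewrite eqxx.
  by rewrite eq_sym fN.
rewrite -(fcard_order_set f_inj (n := 2%N) (a := T)) ?muln2 ?odd_double //.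
by apply/subsetP=> x _; rewrite inE ord2.
Qed.

Section PseudoArcs.
Variables (F : finFieldType) (V : vectType F) (n : nat) (I : finType).
Variables (U : I -> {vspace V}) (Y : {vspace V}).
Hypotheses (n_gt0 : (0 < n)%N) (dimU : forall i, \dim (U i) = n).
Hypotheses (dimY : \dim Y = (3 * n)%N) (UY : forall i, (U i <= Y)%VS).
Hypothesis U_disj : forall i j, i != j -> (U i :&: U j = 0)%VS.
Hypothesis U_indep :
  forall i j k, i != j -> i != k -> j != k -> ((U i + U j) :&: U k = 0)%VS.

(** The component [b] of v in [U j] also lies in [U i + U k]; if j and k differ, independence makes
    it zero and puts v in [U i]. *)
Lemma pseudo_arc_secant i j k v : j != i -> k != i ->
  v \in (U i + U j)%VS -> v \in (U i + U k)%VS -> v \notin U i -> j = k.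
Proof.
move=> ji ki /memv_addP[a ai [b bj ->]] /memv_addP[c ci [d dk eq]].
move=> ab; apply/eqP; apply: contraNT ab => jk.
suff -> : b = 0 by rewrite addr0.
apply/eqP; rewrite -memv0 -(U_indep (i := i) (j := k) (k := j)) 1?eq_sym //.
rewrite memv_cap bj andbT -(addKr a b) eq addrA memv_add //.
by rewrite memvD ?memvN.
Qed.

Let S (W : {vspace V}) := [set v : finvect_type V | v \in W].

Let secants i := \bigcup_(j | j != i) (S (U i + U j) :\: S (U i)).

Let card_secants i :
  #|secants i| = (#|I|.-1 * (#|F| ^ n * (#|F| ^ n).-1))%N.
Proof.
rewrite card_bigcup_disjoint => [|j k v ji ki]; last first.
  rewrite !inE => /andP[vi vj] /andP[_ vk].
  exact: (pseudo_arc_secant ji ki vj vk vi).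
transitivity (\sum_(j | j != i) (#|F| ^ n * (#|F| ^ n).-1))%N.
  apply: eq_bigr => j ji; rewrite cardsD (setIidPr _); last first.
    by apply/subsetP=> v; rewrite !inE; apply/subvP/addvSl.
  rewrite !card_vspace_set dimv_disjoint_sum ?U_disj 1?eq_sym // !dimU.
  by rewrite expnD -subn1 mulnBr muln1.
by rewrite sum_nat_const -(cardC1 i).
Qed.

Let card_outside i :
  #|S Y :\: S (U i)| = (((#|F| ^ n).+1) * (#|F| ^ n * (#|F| ^ n).-1))%N.
Proof.
rewrite cardsD (setIidPr _); last first.
  by apply/subsetP=> v; rewrite !inE; apply/subvP/UY.
rewrite !card_vspace_set dimU dimY mulSn mul2n -addnn !expnD.
have : (0 < #|F| ^ n)%N by rewrite expn_gt0 (ltnW (finNzRing_gt1 F)).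
by move: (#|F| ^ n)%N => [//|Q] _; nia.
Qed.

Let secants_sub i : secants i \subset S Y :\: S (U i).
Proof.
apply/bigcupsP=> j _; apply/setSD/subsetP=> v; rewrite !inE.
by apply/subvP; rewrite subv_add !UY.
Qed.

Let Q_gt1 : (1 < #|F| ^ n)%N.
Proof. by rewrite -(exp1n n) ltn_exp2r ?finNzRing_gt1. Qed.

(** Put Q = q^n. The #|I| - 1 secant spaces through a fixed [U i] are disjoint off [U i] and have
    Q(Q - 1) vectors there, while [Y] has (Q + 1)Q(Q - 1) such vectors. *)
Lemma pseudo_arc_bound : (#|I| <= #|F| ^ n + 2)%N.
Proof.
case: (posnP #|I|) => [->//|/card_gt0P[i _]].
have := subset_leq_card (secants_sub i); rewrite card_secants card_outside.
rewrite leq_pmul2r; last by rewrite muln_gt0; move: Q_gt1; lia.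
by lia.
Qed.

(* If the bound is attained, each point off the pseudo-arc lies on exactly one *)
(* secant <U i, U j> through each U i, so the elements are paired up.          *)
Lemma pseudo_arc_bound_odd :
  odd #|F| -> (#|I| <= #|F| ^ n + 1)%N.
Proof.
move=> q_odd; have Q_odd : odd (#|F| ^ n) by rewrite oddX q_odd orbT.
rewrite leqNgt; apply/negP=> cardI.
have {}cardI : #|I| = (#|F| ^ n + 2)%N.
  by apply/eqP; rewrite eqn_leq pseudo_arc_bound addn2; rewrite addn1 in cardI.
have all_secants i (v : finvect_type V) : v \in Y -> v \notin U i ->
    exists j, (j != i) && (v \in (U i + U j)%VS).
  move=> vY vi; have : v \in secants i.
    have /eqP-> : secants i == S Y :\: S (U i).
      rewrite eqEcard secants_sub card_secants card_outside cardI addn2 /=.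
      exact: leqnn.
    by rewrite !inE vi.
  by case/bigcupP=> j ji; rewrite !inE => /andP[_ vj]; exists j; rewrite ji.
(* The elements cover at most (Q + 2)Q vectors, fewer than Q^3 because Q is odd and so at least
   3. *)
have [v vY vU] : exists2 v : V, v \in Y & forall i, v \notin U i.
  have /subsetPn[v] : ~~ (S Y \subset \bigcup_i S (U i)).
    apply/negP=> /subset_leq_card; rewrite leqNgt => /negP; apply.
    apply: (@leq_ltn_trans (\sum_i #|S (U i)|)).
      elim/big_rec2: _ => [|i m A _ IH]; first by rewrite cards0.
      by apply: leq_trans (leq_card_setU _ _) _; rewrite leq_add2l.
    under eq_bigr do rewrite card_vspace_set dimU.
    rewrite sum_nat_const cardI card_vspace_set dimY mulSn mul2n -addnn !expnD.
    by move: Q_odd Q_gt1; move: (#|F| ^ n)%N => [|[|[|Q]]] //= _ _; nia.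
  rewrite inE => vY /bigcupP vU; exists v => // i.
  by apply/negP=> vi; apply: vU; exists i; rewrite ?inE.
have [f fP] := fin_all_exists (fun i => all_secants i v vY (vU i)).
have fN i : f i != i by have /andP[] := fP i.
have fS i : v \in (U i + U (f i))%VS by have /andP[] := fP i.
(* The secant joining i to [f i] is also the unique one through [f i] containing v. Thus [f] pairs
   up Q + 2 indices, an odd number. *)
have fK : involutive f.
  move=> i; apply: (pseudo_arc_secant (fN (f i)) _ (fS (f i)) _ (vU _)).
    by rewrite eq_sym.
  by rewrite addvC.
by have := odd_card_involution fK fN; rewrite cardI oddD Q_odd.
Qed.

End PseudoArcs.

(** * Pseudo-caps *)

Section FieldReductionActions.
Variables (F : fieldType) (V : vectType F) (n r : nat).
Implicit Types C T : {fset {vspace V}}.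

Lemma field_action_of_extends T : extends_to_desarguesian n r T ->
  exists (L : fieldExtType F) (rho : L -> V -> V),
    [/\ \dim {:L} = n, field_action rho & forall U, U \in T -> stabilizes rho U].
Proof.
case=> S [L [phi [dimL phiP SP]]] TS.
have [rho rhoP phiM] := field_action_of_iso phiP.
exists L, rho; split=> // U /TS/SP[P _]; apply: field_reduces_stabilizes phiM.
by case: phiP.
Qed.

Lemma extends_of_field_action (L : fieldExtType F) (rho : L -> V -> V) T :
  (0 < n)%N -> field_action rho -> \dim {:L} = n -> \dim {:V} = (r * n)%N ->
  (forall U, U \in T -> stabilizes rho U /\ \dim U = n) ->
  extends_to_desarguesian n r T.
Proof.
move=> n_gt0 rhoP dimL dimV TP.
have [|phi phiP phiM] := iso_of_field_action (r := r) rhoP; first by rewrite dimL.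
exists (fun U => exists2 P : {vspace 'rV[L]_r},
                   \dim P = 1%N & field_reduces phi P U).
  by exists L, phi.
move=> U /TP[invU dimU]; have [phi_bij phiD _] := phiP.
have [psi phiK psiK] := phi_bij.
have U0 : vpick U != 0 by rewrite vpick0 -dimv_eq0 dimU -lt0n.
exists <[psi (vpick U)]>%VS.
  rewrite dim_vline; case: eqP => // x0.
  case/eqP: U0; rewrite -[vpick U]psiK x0.
  by apply: (addrI (phi 0)); rewrite -phiD !addr0.
apply: (field_reduces_line rhoP phi_bij phiM invU); rewrite ?dimL ?psiK //.
exact: memv_pick.
Qed.

Lemma field_action_of_elementary C : elementary n r C ->
  exists (L : fieldExtType F) (rho : L -> V -> V),
    [/\ \dim {:L} = n, field_action rho & forall U, U \in C -> stabilizes rho U].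
Proof.
case=> L [phi [K [dimL phiP _ CP]]].
have [rho rhoP phiM] := field_action_of_iso phiP.
exists L, rho; split=> // U /CP[P _]; apply: field_reduces_stabilizes phiM.
by case: phiP.
Qed.

Section PseudoCap.
Variable C : {fset {vspace V}}.
Hypothesis C_cap : pseudo_cap n C.

(** Dimension 3n is the largest possible for the sum of three n-spaces, so the sum is direct. *)
Lemma pseudo_cap_indep U1 U2 U3 : U1 \in C -> U2 \in C -> U3 \in C ->
  U1 != U2 -> U1 != U3 -> U2 != U3 ->
  (U1 :&: U2 = 0)%VS /\ ((U1 + U2) :&: U3 = 0)%VS.
Proof.
move=> C1 C2 C3 n12 n13 n23; have [dimC dim3] := C_cap.
have := dim3 _ _ _ C1 C2 C3 n12 n13 n23.
have := dimv_sum_cap (U1 + U2) U3; have := dimv_sum_cap U1 U2.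
rewrite !(dimC _ C1, dimC _ C2, dimC _ C3) => d12 d123 d.
by split; apply/eqP; rewrite -dimv_eq0; lia.
Qed.

Hypothesis C_gt2 : (2 < #|` C|)%N.

Lemma pseudo_cap_third U1 U2 :
  exists U3, [/\ U3 \in C, U1 != U3 & U2 != U3].
Proof.
have : (0 < #|` (C `\ U1 `\ U2)%fset|)%N.
  have := cardfsD1 U1 C; have := cardfsD1 U2 (C `\ U1)%fset.
  by move: C_gt2; case: (_ \in _); case: (_ \in _); lia.
rewrite cardfs_gt0 => /fset0Pn[U3].
by rewrite !inE => /and3P[n2 n1 C3]; exists U3; rewrite ![_ == U3]eq_sym.
Qed.

(** The definition constrains only triples, so a third element is brought in; this is where [C_gt2]
    enters. *)
Lemma pseudo_cap_disjoint U1 U2 : U1 \in C -> U2 \in C -> U1 != U2 ->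
  (U1 :&: U2 = 0)%VS.
Proof.
move=> C1 C2 n12; have [U3 [C3 n13 n23]] := pseudo_cap_third U1 U2.
by case: (pseudo_cap_indep C1 C2 C3).
Qed.

Lemma induced_dim E U : E \in C -> U \in C -> E != U ->
  \dim (quotv_pi E @: (E + U)) = n.
Proof.
move=> CE CU EU; have [dimC _] := C_cap.
have := limg_ker_dim (quotv_pi E) (E + U).
rewrite lker_quotv_pi (capv_idPr (addvSl _ _)) dimv_disjoint_sum.
  by rewrite !(dimC _ CE, dimC _ CU); lia.
exact: pseudo_cap_disjoint.
Qed.

Lemma elementary_of_field_action (L : fieldExtType F) (rho : L -> V -> V) :
  (0 < n)%N -> field_action rho -> \dim {:L} = n -> \dim {:V} = (r * n)%N ->
  (forall U, U \in C -> stabilizes rho U) -> elementary n r C.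
Proof.
move=> n_gt0 rhoP dimL dimV Cinv; have [dimC _] := C_cap.
have [|phi phiP phiM] := iso_of_field_action (r := r) rhoP; first by rewrite dimL.
have [phi_bij phiD _] := phiP; have [psi phiK psiK] := phi_bij.
have phi0 : phi 0 = 0 by apply: (addrI (phi 0)); rewrite -phiD !addr0.
pose x U := psi (vpick U).
have CP U : U \in C -> [/\ x U != 0, phi (x U) \in U & field_reduces phi <[x U]> U].
  move=> CU; have U0 : vpick U != 0 by rewrite vpick0 -dimv_eq0 dimC // -lt0n.
  have xU : phi (x U) \in U by rewrite psiK memv_pick.
  split=> //.
    by apply: contraNneq U0 => x0; rewrite -[vpick U]psiK -/(x U) x0 phi0.
  apply: (field_reduces_line rhoP phi_bij phiM (Cinv _ CU)); rewrite ?dimC //.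
  by rewrite psiK.
exists L, phi, [fset <[x U]>%VS | U in C]%fset; split=> //; last first.
  move=> U; split=> [CU|[_ /imfsetP[U' /= CU' ->] UP]].
    by exists <[x U]>%VS; [apply/imfsetP; exists U | case: (CP U CU)].
  suff -> : U = U' by [].
  apply/vspaceP=> v; rewrite -[v]psiK UP.
  by case: (CP _ CU') => _ _ ->.
(* Trivial intersections in [V] pull back along [phi], turning independence of n-spaces over [F]
   into independence of points over [L]. *)
have disj0 (P Q : {vspace 'rV[L]_r}) :
    (forall y, y \in P -> y \in Q -> phi y = 0) -> (P :&: Q = 0)%VS.
  move=> PQ; apply/eqP; rewrite -subv0; apply/subvP=> y /memv_capP[yP yQ].
  by rewrite memv0; apply/eqP/(bij_inj phi_bij); rewrite phi0 PQ.
split=> [_ /imfsetP[U /= /CP[x0 _ _] ->]|P1 P2 P3]; first by rewrite dim_vline x0.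
move=> /imfsetP[U1 /= C1 ->] /imfsetP[U2 /= C2 ->] /imfsetP[U3 /= C3 ->].
move=> n12 n13 n23.
have [|||cap12 cap123] := pseudo_cap_indep C1 C2 C3.
- by apply: contraNneq n12 => ->.
- by apply: contraNneq n13 => ->.
- by apply: contraNneq n23 => ->.
have [x1 _ R1] := CP _ C1; have [x2 _ R2] := CP _ C2; have [x3 _ R3] := CP _ C3.
rewrite dimv_disjoint_sum ?dimv_disjoint_sum ?dim_vline ?x1 ?x2 ?x3 //.
  apply: disj0 => y; rewrite -R1 -R2 => y1 y2; apply/eqP.
  by rewrite -memv0 -cap12 memv_cap y1.
apply: disj0 => _ /memv_addP[y1 y1P [y2 y2P ->]]; rewrite -R3 => y3; apply/eqP.
rewrite -memv0 -cap123 memv_cap y3 andbT phiD memv_add //.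
  by rewrite R1.
by rewrite R2.
Qed.

End PseudoCap.
End FieldReductionActions.

(** * Gluing actions on two quotients, and the two implications *)

Lemma limgK (F : fieldType) (V W : vectType F) (g : 'Hom(V, W)) U :
  (lker g <= U)%VS -> (g @^-1: (g @: U))%VS = U.
Proof.
move=> kU; apply/vspaceP=> v; rewrite -memv_preim.
apply/memv_imgP/idP => [[u uU guv]|vU]; last by exists v.
rewrite -(subrK u v) memvD //; apply: (subvP kU).
by rewrite memv_ker linearB /= guv subrr.
Qed.

(** [V] is the fibre product of [Q1] and [Q2] over [W]: disjoint kernels make a vector determined by
    its two images, and the condition on the kernel of [p1 \o g1] makes every compatible pair of
    images occur. The axioms are then checked in [Q1] and [Q2]. *)
Lemma field_action_fibre_product (F : fieldType) (L : fieldExtType F)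
    (V Q1 Q2 W : vectType F) (g1 : 'Hom(V, Q1)) (g2 : 'Hom(V, Q2))
    (p1 : 'Hom(Q1, W)) (p2 : 'Hom(Q2, W)) (rho1 : L -> Q1 -> Q1)
    (rho2 : L -> Q2 -> Q2) (sigma : L -> W -> W) :
  field_action rho1 -> field_action rho2 ->
  (forall a x, sigma a (p1 x) = p1 (rho1 a x)) ->
  (forall a y, sigma a (p2 y) = p2 (rho2 a y)) ->
  limg g1 = fullv -> limg g2 = fullv -> (lker g1 :&: lker g2 = 0)%VS ->
  (forall v, p1 (g1 v) = p2 (g2 v)) ->
  (lker (p1 \o g1) <= lker g1 + lker g2)%VS ->
  exists rho : L -> V -> V,
    [/\ field_action rho, forall a v, rho1 a (g1 v) = g1 (rho a v) &
        forall a v, rho2 a (g2 v) = g2 (rho a v)].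
Proof.
move=> act1 act2 sp1 sp2 full1 full2 cap0 p12 kerp.
have uniq v w : g1 v = g1 w -> g2 v = g2 w -> v = w.
  move=> /eqP e1 /eqP e2; apply/eqP; rewrite -subr_eq0 -memv0 -cap0 memv_cap.
  by rewrite !memv_ker !linearB /= !subr_eq0 e1.
(* Lifts [w1], [w2] of the two targets have the same image in [W], so they differ by [e1 + e2] with
   each [e] in one kernel; [w1 - e1] equals [w2 + e2] and lifts both. *)
have ex a v : exists w, (g1 w == rho1 a (g1 v)) && (g2 w == rho2 a (g2 v)).
  have /memv_imgP[w1 _ E1] : rho1 a (g1 v) \in limg g1 by rewrite full1 memvf.
  have /memv_imgP[w2 _ E2] : rho2 a (g2 v) \in limg g2 by rewrite full2 memvf.
  have /(subvP kerp)/memv_addP[e1 e1P [e2 e2P w12]] : w1 - w2 \in lker (p1 \o g1).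
    rewrite memv_ker comp_lfunE /= !linearB /= [p1 (g1 w2)]p12 -E1 -E2 -sp1 -sp2.
    by rewrite p12 subrr.
  exists (w1 - e1); move: e1P e2P; rewrite !memv_ker => /eqP e1P /eqP e2P.
  have -> : w1 - e1 = w2 + e2.
    by apply/eqP; rewrite subr_eq -addrA [e2 + _]addrC -w12 addrC subrK.
  rewrite E2 !linearD /= e2P addr0 eqxx andbT -[g1 w2 + _]linearD /=.
  have -> : w2 + e2 = w1 - e1.
    by apply/eqP; rewrite eq_sym subr_eq -addrA [e2 + _]addrC -w12 addrC subrK.
  by rewrite linearB /= e1P subr0 E1.
pose rho a v := xchoose (ex a v).
have g1E a v : g1 (rho a v) = rho1 a (g1 v).
  by have /andP[/eqP] := xchooseP (ex a v).
have g2E a v : g2 (rho a v) = rho2 a (g2 v).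
  by have /andP[_ /eqP] := xchooseP (ex a v).
exists rho; split=> //; split=> [a b v|a u v|a b v|c v]; apply: uniq;
  rewrite ?(linearD, linearZ) /= ?(g1E, g2E) ?(linearD, linearZ) /= ?(g1E, g2E).
- exact: fact_Dl.
- exact: fact_Dl.
- exact: fact_Dr.
- exact: fact_Dr.
- exact: fact_M.
- exact: fact_M.
- exact: fact_scalar.
- exact: fact_scalar.
Qed.

Lemma leq_card_fibres (K K' : choiceType) (A : {fset K}) (f : K -> K') c :
  (forall x, x \in A -> #|` [fset y in A | f y == f x]%fset| <= c)%N ->
  (#|` A| <= #|` [fset f x | x in A]%fset| * c)%N.
Proof.
move=> fib; rewrite card_fset_sum1 (partition_big_imfset _ f) /=.
rewrite card_fset_sum1 big_distrl /=; rewrite big_seq [leqRHS]big_seq.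
apply: leq_sum => _ /imfsetP[x /= xA ->]; rewrite mul1n.
by rewrite big_fset_condE -card_fset_sum1 fib.
Qed.

Lemma pseudo_cap_in_span (F : finFieldType) (V : vectType F) (n : nat)
    (C : {fset {vspace V}}) (Y : {vspace V}) :
  (0 < n)%N -> pseudo_cap n C -> (2 < #|` C|)%N -> \dim Y = (3 * n)%N ->
  (forall U, U \in C -> (U <= Y)%VS) ->
  (#|` C| <= #|F| ^ n + (if odd #|F| then 1 else 2))%N.
Proof.
move=> n_gt0 C_cap C_gt2 dimY CY; rewrite cardfE; have [dimC _] := C_cap.
have bound : (#|{: C}| <= #|F| ^ n + 2)%N /\
    (odd #|F| -> #|{: C}| <= #|F| ^ n + 1)%N.
  have Cdim (i : C) : \dim (val i) = n by apply: dimC; apply: valP.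
  have CsubY (i : C) : (val i <= Y)%VS by apply: CY; apply: valP.
  have Cdisj (i j : C) : i != j -> (val i :&: val j = 0)%VS.
    by rewrite -val_eqE; apply: (pseudo_cap_disjoint C_cap C_gt2 (valP i) (valP j)).
  have Cindep (i j k : C) : i != j -> i != k -> j != k ->
      ((val i + val j) :&: val k = 0)%VS.
    rewrite -!val_eqE => ij ik jk.
    by have [] := pseudo_cap_indep C_cap (valP i) (valP j) (valP k) ij ik jk.
  split; first exact: (pseudo_arc_bound n_gt0 Cdim dimY CsubY Cdisj Cindep).
  exact: (pseudo_arc_bound_odd n_gt0 Cdim dimY CsubY Cdisj Cindep).
by case: bound; case: ifP => // _ ? ?; auto.
Qed.

Lemma induced_partial_spread_extends (F : fieldType) (V : vectType F) (n r : nat)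
    (C : {fset {vspace V}}) (E : {vspace V}) :
  (0 < n)%N -> \dim {:V} = (r.+1 * n)%N -> pseudo_cap n C -> (2 < #|` C|)%N ->
  elementary n r.+1 C -> E \in C ->
  extends_to_desarguesian n r (induced_partial_spread C E).
Proof.
move=> n_gt0 dimV C_cap C_gt2.
move=> /field_action_of_elementary[L [rho [dimL rhoP Cinv]]] CE.
have [|sigma sigmaP sigmaE] := field_action_image rhoP (limg_quotv_pi E).
  by rewrite lker_quotv_pi; apply: Cinv.
apply: (extends_of_field_action n_gt0 sigmaP dimL).
  rewrite dim_quotv dimV; have [dimC _] := C_cap.
  by rewrite (dimC _ CE) mulSn addKn.
move=> _ /imfsetP[U /= /fsetD1P[UE CU] ->]; split.
  by apply: (stabilizes_img sigmaE); apply: stabilizes_add => //; apply: Cinv.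
by apply: induced_dim C_cap C_gt2 _ _ CE CU _; rewrite eq_sym.
Qed.

(** The largeness hypothesis is read with c the number of images in [V / (E1 + E2)]; the factor of c
    is the maximal size of a pseudo-arc in a 3n-space, less [E1] and [E2], and the final 2 restores
    these. *)
Lemma elementary_of_two_induced (F : finFieldType) (V : vectType F) (n k : nat)
    (C : {fset {vspace V}}) (E1 E2 : {vspace V}) :
  (0 < n)%N -> \dim {:V} = (4 * n)%N ->
  (forall d, d %| n -> d != n -> d <= k)%N ->
  pseudo_cap n C -> (2 < #|` C|)%N ->
  (forall c, (#|` C| <= c * (#|F| ^ n + (if odd #|F| then 1 else 2) - 2) + 2)%N ->
     (#|F| ^ k + 1 < c)%N) ->
  E1 \in C -> E2 \in C -> E1 != E2 ->
  extends_to_desarguesian n 3 (induced_partial_spread C E1) ->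
  extends_to_desarguesian n 3 (induced_partial_spread C E2) ->
  elementary n 4 C.
Proof.
move=> n_gt0 dimV k_max C_cap C_gt2 C_large CE1 CE2 E12.
have [dimC dim3C] := C_cap.
have dimE1 := dimC _ CE1; have dimE2 := dimC _ CE2.
move=> /field_action_of_extends[L1 [rho1 [dimL1 act1 inv1]]].
move=> /field_action_of_extends[L2 [rho2 [dimL2 act2 inv2]]].
have cap12 : (E1 :&: E2 = 0)%VS by apply: (pseudo_cap_disjoint C_cap C_gt2).
pose g1 := quotv_pi E1; pose g2 := quotv_pi E2; pose h := quotv_pi (E1 + E2).
have full1 : limg g1 = fullv := limg_quotv_pi E1.
have full2 : limg g2 = fullv := limg_quotv_pi E2.
have ker1 : lker g1 = E1 := lker_quotv_pi E1.
have ker2 : lker g2 = E2 := lker_quotv_pi E2.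
have kerh : lker h = (E1 + E2)%VS := lker_quotv_pi (E1 + E2).
have factor (Q : vectType F) (g : 'Hom(V, Q)) : limg g = fullv ->
    (lker g <= E1 + E2)%VS ->
    let p := (h \o g^-1)%VF in
    [/\ forall v, p (g v) = h v, limg p = fullv & lker p = (g @: (E1 + E2))%VS].
  move=> gfull kerg p; have pg v : p (g v) = h v.
    apply/eqP; rewrite comp_lfunE -subr_eq0 -linearB -memv_ker kerh.
    apply: (subvP kerg); rewrite memv_ker linearB /= limg_lfunVK ?subrr //.
    by rewrite gfull memvf.
  split=> //.
    apply/eqP; rewrite eqEsubv subvf -(limg_quotv_pi (E1 + E2)).
    by apply/subvP=> _ /memv_imgP[v _ ->]; rewrite -/h -pg memv_img ?memvf.
  apply/vspaceP=> x; have /memv_imgP[v _ ->] : x \in limg g by rewrite gfull memvf.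
  rewrite memv_ker pg -memv_ker kerh; apply/idP/idP => [/(memv_img g)//|].
  by rewrite memv_preim limgK.
pose p1 := (h \o g1^-1)%VF; pose p2 := (h \o g2^-1)%VF.
have [|pg1 pfull1 kerp1] := factor _ g1 full1; first by rewrite ker1 addvSl.
have [|pg2 pfull2 kerp2] := factor _ g2 full2; first by rewrite ker2 addvSr.
have inv1' U : U \in C -> U != E1 -> stabilizes rho1 (g1 @: (E1 + U)).
  by move=> CU UE; apply/inv1/imfsetP; exists U; rewrite // !inE UE.
have inv2' U : U \in C -> U != E2 -> stabilizes rho2 (g2 @: (E2 + U)).
  by move=> CU UE; apply/inv2/imfsetP; exists U; rewrite // !inE UE.
(* The kernel of [p1] is the image of [E2] in [V / E1], an element of the induced partial spread and
   hence stable, so [rho1] descends to [V / (E1 + E2)]. *)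
have [|sigma1 sact1 sE1] := field_action_image act1 pfull1.
  by rewrite kerp1; apply: inv1'; rewrite // eq_sym.
have [|sigma2 sact2 sE2] := field_action_image act2 pfull2.
  by rewrite kerp2 addvC; apply: inv2'.
pose D := (C `\ E1 `\ E2)%fset.
have DP U : U \in D -> [/\ U \in C, U != E1 & U != E2].
  by rewrite !inE => /and3P[].
have cardD : #|` C| = (#|` D| + 2)%N.
  have CE2' : E2 \in (C `\ E1)%fset by apply/fsetD1P; rewrite eq_sym.
  have c1 := cardfsD1 E1 C; have c2 := cardfsD1 E2 (C `\ E1)%fset.
  rewrite CE1 in c1; rewrite CE2' in c2; apply: (etrans c1).
  by rewrite addn2; congr (_.+1).
have h_img1 U : (h @: U = p1 @: (g1 @: (E1 + U)))%VS.
  rewrite -limg_comp (_ : (p1 \o g1)%VF = h); last first.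
    by apply/lfunP=> v; rewrite comp_lfunE pg1.
  rewrite limgD (_ : (h @: E1)%VS = 0%VS) ?add0v //.
  by apply/eqP; rewrite -lkerE kerh addvSl.
have h_img2 U : (h @: U = p2 @: (g2 @: (E2 + U)))%VS.
  rewrite -limg_comp (_ : (p2 \o g2)%VF = h); last first.
    by apply/lfunP=> v; rewrite comp_lfunE pg2.
  rewrite limgD (_ : (h @: E2)%VS = 0%VS) ?add0v //.
  by apply/eqP; rewrite -lkerE kerh addvSr.
have h_sinv1 U : U \in D -> stabilizes sigma1 (h @: U).
  move=> /DP[CU UE1 _]; rewrite h_img1; apply: (stabilizes_img sE1); exact: inv1'.
have h_sinv2 U : U \in D -> stabilizes sigma2 (h @: U).
  move=> /DP[CU _ UE2]; rewrite h_img2; apply: (stabilizes_img sE2); exact: inv2'.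
have cap3 U : U \in D -> ((E1 + E2) :&: U = 0)%VS.
  move=> /DP[CU UE1 UE2].
  by have [] := pseudo_cap_indep C_cap CE1 CE2 CU E12; rewrite // eq_sym.
have h_dim U : U \in D -> \dim (h @: U) = n.
  move=> UD; have [CU _ _] := DP _ UD; rewrite limg_dim_eq ?dimC //.
  by rewrite kerh capvC cap3.
have dimE : \dim (E1 + E2) = (2 * n)%N.
  by rewrite dimv_disjoint_sum // dimE1 dimE2 mul2n addnn.
have dimW : \dim {: quotv (E1 + E2)} = (2 * n)%N.
  by rewrite dim_quotv dimV dimE -mulnBl.
pose X := [fset (h @: U)%VS | U in D]%fset.
have cardX : (#|F| ^ k + 1 < #|{: X}|)%N.
  rewrite -cardfE; apply: C_large; rewrite cardD leq_add2r.
  apply: leq_card_fibres => U0 UD0; have [CU0 UE10 UE20] := DP _ UD0.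
  set G := [fset U in D | _]%fset.
  have GP U : U \in G -> U \in D /\ (h @: U = h @: U0)%VS.
    by rewrite !inE => /andP[-> /eqP].
  have U0G : U0 \in G by move: UD0; rewrite !inE eqxx andbT.
  pose A := (E1 |` (E2 |` G))%fset.
  have AC U : U \in A -> U \in C.
    by move=> /fset1UP[->|/fset1UP[->|/GP[/DP[]]]].
  have cardA : #|` A| = (#|` G| + 2)%N.
    have E2G : E2 \notin G by apply/negP=> /GP[/DP[_ _ /eqP]].
    have E1G : E1 \notin (E2 |` G)%fset.
      by apply/fset1UP=> -[/eqP|/GP[/DP[_ /eqP]]//]; rewrite (negPf E12).
    by rewrite /A cardfsU1 E1G cardfsU1 E2G addnA addnC.
  have Q_gt1 : (1 < #|F| ^ n)%N by rewrite -(exp1n n) ltn_exp2r ?finNzRing_gt1.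
  rewrite -(leq_add2r 2) -cardA subnK; last exact: leq_trans Q_gt1 (leq_addr _ _).
  (* All elements with the image of [U0] lie in this 3n-space, as do [E1] and [E2]. *)
  apply: (pseudo_cap_in_span (Y := (E1 + E2 + U0)%VS) n_gt0).
  - by split=> [U /AC/dimC//|U1 U2 U3 /AC A1 /AC A2 /AC A3]; apply: dim3C.
  - by rewrite cardA addn2 !ltnS cardfs_gt0; apply/fset0Pn; exists U0.
  - by rewrite dim3C // eq_sym.
  move=> U /fset1UP[->|/fset1UP[->|/GP[UD hU]]].
  - by rewrite -addvA addvSl.
  - by rewrite addvC addvA addvSr.
  apply/subvP=> u /(memv_img h); rewrite hU => /memv_imgP[w wU0 huw].
  rewrite -(subrK w u) memv_add // -kerh memv_ker linearB /= huw subrr //.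
have XP (i : X) : exists2 U, U \in D & val i = (h @: U)%VS.
  by have /imfsetP[U /= UD ->] := valP i; exists U.
have [|||theta thE] := common_lines_transfer sact1 sact2 dimL1 dimL2 dimW k_max
    (X := fun i : X => val i) val_inj _ _ _ cardX.
- by move=> i; have [U UD ->] := XP i; apply: h_dim.
- by move=> i; have [U UD ->] := XP i; apply: h_sinv1.
- by move=> i; have [U UD ->] := XP i; apply: h_sinv2.
have [|thD thM thS] := faithful_ring_morphism sact1 sact2 _ thE.
  by rewrite dimW muln_gt0.
(* Twisting by [theta] lets the single field [L1] act on both quotients, with the same action on
   [V / (E1 + E2)]. *)
have act2' : field_action (fun a => rho2 (theta a)).
  split=> [a b v|a u v|a b v|c v].
  - by rewrite thD (fact_Dl act2).
  - exact: fact_Dr.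
  - by rewrite thM (fact_M act2).
  - by rewrite thS (fact_scalar act2).
have [||||rho [rhoP rho_g1 rho_g2]] := field_action_fibre_product (p2 := p2)
  act1 act2' sE1 _ full1 full2 _ _ _.
- by move=> a y; rewrite thE sE2.
- by rewrite ker1 ker2.
- by move=> v; rewrite pg1 pg2.
- rewrite ker1 ker2; apply/subvP=> v.
  by rewrite memv_ker comp_lfunE pg1 -memv_ker kerh.
have rinv1 U : U \in C -> U != E1 -> stabilizes rho (E1 + U).
  move=> CU UE; rewrite -(limgK (g := g1) (U := E1 + U)) ?ker1 ?addvSl //.
  by apply: (stabilizes_preim rho_g1); apply: inv1'.
have rinv2 U : U \in C -> U != E2 -> stabilizes rho (E2 + U).
  move=> CU UE; rewrite -(limgK (g := g2) (U := E2 + U)) ?ker2 ?addvSl //.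
  apply: (stabilizes_preim (sigma := fun a => rho2 (theta a)) rho_g2).
  by move=> a v; apply: inv2'.
have stab_ker (Q : vectType F) (g : 'Hom(V, Q)) (tau : L1 -> Q -> Q) :
    field_action tau -> (forall a v, tau a (g v) = g (rho a v)) ->
    stabilizes rho (lker g).
  move=> tauP tau_g a v; rewrite !memv_ker -tau_g => /eqP->.
  by rewrite (fact_0r tauP).
apply: (elementary_of_field_action C_cap n_gt0 rhoP dimL1 dimV) => U CU.
have [->|UE1] := eqVneq U E1; first by rewrite -ker1; apply: stab_ker rho_g1.
have [->|UE2] := eqVneq U E2; first by rewrite -ker2; apply: stab_ker act2' rho_g2.
have cap0 : (E1 :&: (U + E2) = 0)%VS.
  have [|_ cap] := pseudo_cap_indep C_cap CU CE2 CE1 UE2 UE1.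
    by rewrite eq_sym.
  by rewrite capvC.
(* By the modular law the intersection is [U] plus the meet of [E1] with [U + E2], which is zero. *)
have <- : ((E1 + U) :&: (E2 + U) = U)%VS.
  rewrite [(E1 + U)%VS]addvC [(E2 + U)%VS]addvC -vspace_modl ?addvSl //.
  by rewrite cap0 addv0.
by apply: stabilizes_cap; [apply: rinv1 | apply: rinv2].
Qed.

Local Open Scope nat_scope.
Local Open Scope fset_scope.

Theorem theorem3p5 (q n k : nat) (F : finFieldType)
    (C : {fset {vspace 'rV[F]_(4 * n)}})
    (card_F : #|F| = q) (q_gt2 : 2 < q) (n_ge2 : 2 <= n)
    (k_dvd : k %| n) (k_neq : k != n)
    (k_max : forall d : nat, d %| n -> d != n -> d <= k)
    (C_pseudo_cap : pseudo_cap n C)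
    (C_odd : odd q -> #|` C| > q ^ (n + k) + q ^ n - q ^ k + 1)
    (C_even : ~~ odd q -> #|` C| > q ^ (n + k) + q ^ n + 2) :
  elementary n 4 C <->
  exists E1 E2 : {vspace 'rV[F]_(4 * n)},
    [/\ E1 \in C, E2 \in C, E1 != E2,
        extends_to_desarguesian n 3 (induced_partial_spread C E1) &
        extends_to_desarguesian n 3 (induced_partial_spread C E2)].
Proof.
have n_gt0 : 0 < n by apply: leq_trans n_ge2.
have dimV : \dim {: 'rV[F]_(4 * n)} = 4 * n by rewrite dimvf /dim /= mul1n.
have qn_gt2 : 2 < q ^ n.
  by rewrite (leq_trans q_gt2) // -{1}(expn1 q) leq_pexp2l // (ltn_trans _ q_gt2).
have qk_gt0 : 0 < q ^ k by rewrite expn_gt0 (ltn_trans _ q_gt2).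
rewrite !expnD in C_odd C_even.
have C_gt2 : 2 < #|` C|.
  by case: (boolP (odd q)) => [/C_odd|/C_even]; move: qn_gt2 qk_gt0; nia.
split=> [C_elem|[E1 [E2 [CE1 CE2 E12 ext1 ext2]]]].
  have [E1 CE1] : exists E1, E1 \in C.
    by apply/fset0Pn; rewrite -cardfs_gt0 (ltn_trans _ C_gt2).
  have [E2 [CE2 E12 _]] := pseudo_cap_third C_gt2 E1 E1.
  by exists E1, E2; split=> //; apply: induced_partial_spread_extends C_elem _.
apply: (elementary_of_two_induced n_gt0 dimV k_max C_pseudo_cap C_gt2 _
          CE1 CE2 E12 ext1 ext2) => c; rewrite card_F.
(* With c at most q^k + 1, the size is at most (q^k + 1)(q^n - 1) + 2 for odd q and (q^k + 1)q^n + 2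
   for even q: exactly the two assumed thresholds. *)
case: (boolP (odd q)) => [/C_odd|/C_even] big le_c; rewrite ltnNge;
  by apply/negP=> c_le; move: big le_c c_le qn_gt2 qk_gt0; nia.
Qed.
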